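(* There is a constant $\eta>0$ such that for each graph $G$, each vertex partition $\mathcal{A}$ of $G$ and each $0<p<1$ the following holds with $\mu=\mu(G,p)=e(G)\,p$. For each $t\ge 0$, $$\Pr\Big(\big|q_{\mathcal{A}}(G_p)-\mathbb{E}[q_{\mathcal{A}}(G_p)]\big|\ge t\Big)<2e^{-\eta\mu t^2}\quad\text{and}\quad\Pr\Big(\big|q^*(G_p)-\mathbb{E}[q^*(G_p)]\big|\ge t\Big)<2e^{-\eta\mu t^2}.$$
   Context: Graphs are finite and simple; $e(G)$ is the number of edges of $G$. For a graph $G$ with $m\ge 1$ edges and a vertex partition $\mathcal{A}$, the modularity score is $q_{\mathcal{A}}(G)=\frac1m\sum_{A\in\mathcal{A}}e(A)-\frac1{4m^2}\sum_{A\in\mathcal{A}}\mathrm{vol}(A)^2$, where $e(A)$ is the number of edges inside $A$ and $\mathrm{vol}(A)$ is the sum of the degrees of the vertices in $A$. If $G$ has no edges then $q_{\mathcal{A}}(G)=0$. The modularity is $q^*(G)=\max_{\mathcal{A}}q_{\mathcal{A}}(G)$ over all vertex partitions. $G_p$ is the random subgraph of $G$ on the same vertex set obtained by keeping each edge of $G$ independently with probability $p$. *)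

(* Defs.v *)
From HB Require Import structures.
From mathcomp Require Import all_boot all_order all_algebra.

Set Implicit Arguments.
Unset Strict Implicit.
Unset Printing Implicit Defensive.

Import Order.TTheory GRing.Theory Num.Theory.
Local Open Scope ring_scope.

(* A simple graph on the vertex set T is given by its edge set, a set of
   2-element subsets of T (hence no loops and no multiple edges). *)
Definition simple_graph (T : finType) (E : {set {set T}}) : Prop :=
  forall e : {set T}, e \in E -> #|e| = 2%N.

Definition edges_within (T : finType) (E : {set {set T}}) (A : {set T}) : nat :=
  #|[set e in E | e \subset A]|.

Definition degree (T : finType) (E : {set {set T}}) (v : T) : nat :=
  #|[set e in E | v \in e]|.

Definition volume (T : finType) (E : {set {set T}}) (A : {set T}) : nat :=
  (\sum_(v in A) degree E v)%N.

Definition modularity_score (R : realFieldType) (T : finType)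
    (P : {set {set T}}) (E : {set {set T}}) : R :=
  if E == set0 then 0
  else (#|E|%:R)^-1 * (\sum_(A in P) (edges_within E A)%:R)
       - (4 * #|E|%:R ^+ 2)^-1 * (\sum_(A in P) (volume E A)%:R ^+ 2).
Arguments modularity_score R {T} P E.

(* The partition into singletons. *)
Definition discrete_partition (T : finType) : {set {set T}} :=
  preim_partition id [set: T].

(* The default value of the iterated maximum is the score of an actual
   partition, so this is the maximum over all partitions:
   see modularity_ub and modularity_attained. *)
Definition modularity (R : realFieldType) (T : finType)
    (E : {set {set T}}) : R :=
  \big[Num.max/modularity_score R (discrete_partition T) E]_(P : {set {set T}}
      | partition P [set: T]) modularity_score R P E.
Arguments modularity R {T} E.

(* Probability that the set of kept edges is exactly F, for F \subset E, when
   each edge of E is kept independently with probability p. *)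
Definition percolation_weight (R : realFieldType) (T : finType)
    (E : {set {set T}}) (p : R) (F : {set {set T}}) : R :=
  \prod_(e in E) (if e \in F then p else 1 - p).

Definition percolation_prob (R : realFieldType) (T : finType)
    (E : {set {set T}}) (p : R) (event : pred {set {set T}}) : R :=
  \sum_(F in powerset E | event F) percolation_weight E p F.

Definition percolation_expect (R : realFieldType) (T : finType)
    (E : {set {set T}}) (p : R) (X : {set {set T}} -> R) : R :=
  \sum_(F in powerset E) percolation_weight E p F * X F.

Lemma discrete_partitionP (T : finType) :
  partition (discrete_partition T) [set: T].
Proof. exact: preim_partitionP. Qed.

Lemma modularity_ub (R : realFieldType) (T : finType) (E P : {set {set T}}) :
  partition P [set: T] -> modularity_score R P E <= modularity R E.
Proof. by move=> partP; exact: (le_bigmax_cond _ (modularity_score R ^~ E)). Qed.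

Lemma modularity_attained (R : realFieldType) (T : finType)
    (E : {set {set T}}) :
  exists2 P : {set {set T}}, partition P [set: T]
    & modularity R E = modularity_score R P E.
Proof.
rewrite /modularity.
pose K (x : R) := exists2 P : {set {set T}}, partition P [set: T]
  & x = modularity_score R P E.
apply: (big_ind K) => [||P partP]; last by exists P.
  by exists (discrete_partition T) => //; exact: discrete_partitionP.
move=> _ _ [P partP ->] [Q partQ ->].
by rewrite maxElt; case: ifP => _; [exists Q | exists P].
Qed.

Lemma percolation_prob_superset (R : realFieldType) (T : finType)
    (E S : {set {set T}}) (p : R) :
  S \subset E -> percolation_prob E p (fun F => S \subset F) = p ^+ #|S|.
Proof.
move=> sSE.
transitivity (\prod_e ((if e \in E then p else 0) +
   (if e \in S then 0 else if e \in E then 1 - p else 1))).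
  rewrite bigA_distr /percolation_prob big_mkcond /=.
  apply: eq_bigr => F _; rewrite powersetE.
  case: ifPn => [/andP[sFE sSF]|].
    rewrite /percolation_weight big_mkcond /=; apply: eq_bigr => e _.
    case: (boolP (e \in F)) => eF; first by rewrite (subsetP sFE _ eF).
    by rewrite (contraNF (subsetP sSF e) eF).
  rewrite negb_and => /orP[] /subsetPn[e e1 e2]; symmetry.
    by rewrite (bigD1 e) //= e1 (negbTE e2) mul0r.
  by rewrite (bigD1 e) //= e1 (negbTE e2) mul0r.
rewrite -prodr_const [RHS]big_mkcond /=; apply: eq_bigr => e _.
case: (boolP (e \in S)) => [/(subsetP sSE) ->|_]; first by rewrite addr0.
by case: ifP => _; rewrite ?add0r // addrC subrK.
Qed.

Lemma percolation_prob_total (R : realFieldType) (T : finType)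
    (E : {set {set T}}) (p : R) : percolation_prob E p predT = 1.
Proof.
rewrite -[RHS](expr0 p) -(cards0 {set T}).
rewrite -(percolation_prob_superset p (sub0set E)).
by apply: eq_bigl => F; rewrite sub0set.
Qed.

(* Main.v *)
Require Import Defs.
From mathcomp Require Import all_boot all_order all_algebra.
From mathcomp Require Import reals sequences exp.
From mathcomp Require Import ring lra zify.

Set Implicit Arguments.
Unset Strict Implicit.
Unset Printing Implicit Defensive.

Import Order.TTheory GRing.Theory Num.Theory.
Local Open Scope ring_scope.

(** Let [X] be the modularity score of a fixed partition, or the modularity,
    and let [mu] be the expected number of kept edges.  The score is the
    probability that a uniform edge lies inside a part, minus the probability
    that two independent degree-biased vertices lie in the same part.  Adding
    an edge to a graph with [m] edges moves the empirical edge distribution by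
    [1 / (m + 1)] in total variation, hence the score by at most
    [1 / (m + 1) + 2 / (m + 1)]; a maximum of such functions has the same
    property.  So [(m + 1) |X (e |: F) - X F| <= 3]
    ([modularity_score_setU1], [modularity_setU1]), while [|X| <= 1].

    This Lipschitz constant is of order [1 / mu] when [m] is of order [mu], but
    it is bad for sparse subgraphs.  Multiplying [X] by [min (1, 2 m / mu)]
    repairs this: the product is [8 / mu]-Lipschitz on all subgraphs
    ([edge_truncation_lipschitz]) and equals [X] unless [m <= mu / 2].

    A function that is [c]-Lipschitz in the edges satisfies a Bernstein-type
    bound ([percolation_expR_le]): each of the edges of [E] contributes variance
    at most [p c ^ 2], so that [c = 8 / mu] gives total variance of order
    [1 / mu] and tails [exp (- const * mu * t ^ 2)] for [t <= 2], the
    only relevant range.  The exponential moment is bounded by induction on the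
    edge set, revealing one edge at a time.  The same bound applied to the
    number of edges shows that [m <= mu / 2] has probability at most
    [exp (- mu / 32)], which controls both the event on which [X] and its
    truncation differ and the difference of their expectations.  The
    resulting sum of three exponentials is brought under [2 exp (- eta mu t ^ 2)]
    by taking [eta] half as large, probabilities being at most [1]
    ([scaled_lipschitz_concentration]). *)

(** * Expectation under edge percolation *)

Section Percolation.
Variables (R : realFieldType) (T : finType).
Implicit Types (E F : {set {set T}}) (e : {set T}) (p c : R).
Implicit Types (X Y : {set {set T}} -> R).

Lemma percolation_weight_ge0 E p F :
  0 <= p <= 1 -> 0 <= percolation_weight E p F.
Proof.
by case/andP=> p0 p1; apply: prodr_ge0 => e _; case: ifP; rewrite ?subr_ge0.
Qed.

Lemma percolation_probE E p (A : pred {set {set T}}) :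
  percolation_prob E p A = percolation_expect E p (fun F => (A F)%:R).
Proof.
rewrite /percolation_prob big_mkcondr /=; apply: eq_bigr => F _.
by case: (A F); rewrite ?mulr1 ?mulr0.
Qed.

Lemma percolation_expectD E p X Y :
  percolation_expect E p (fun F => X F + Y F)
  = percolation_expect E p X + percolation_expect E p Y.
Proof. by rewrite -big_split; apply: eq_bigr => F _; rewrite /= mulrDr. Qed.

Lemma percolation_expectZ E p X c :
  percolation_expect E p (fun F => c * X F) = c * percolation_expect E p X.
Proof.
by rewrite /percolation_expect mulr_sumr; apply: eq_bigr => F _; rewrite mulrCA.
Qed.

Lemma percolation_expect_cst E p c : percolation_expect E p (fun=> c) = c.
Proof.
rewrite /percolation_expect -mulr_suml -[RHS]mul1r; congr (_ * _).
rewrite -[RHS](percolation_prob_total E p).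
by apply: eq_bigl => F; rewrite andbT.
Qed.

Lemma percolation_expectN E p X :
  percolation_expect E p (fun F => - X F) = - percolation_expect E p X.
Proof.
rewrite -mulN1r -percolation_expectZ.
by apply: eq_bigr => F _; rewrite mulN1r.
Qed.

Lemma percolation_expectB E p X Y :
  percolation_expect E p (fun F => X F - Y F)
  = percolation_expect E p X - percolation_expect E p Y.
Proof. by rewrite -percolation_expectN -percolation_expectD. Qed.

Lemma ler_percolation_expect E p X Y :
  0 <= p <= 1 -> (forall F, F \subset E -> X F <= Y F) ->
  percolation_expect E p X <= percolation_expect E p Y.
Proof.
move=> p01 XY; apply: ler_sum => F; rewrite powersetE => sFE.
by rewrite ler_wpM2l ?XY ?percolation_weight_ge0.
Qed.

Lemma ler_norm_percolation_expect E p X c :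
  0 <= p <= 1 -> (forall F, F \subset E -> `|X F| <= c) ->
  `|percolation_expect E p X| <= c.
Proof.
move=> p01 Xc; rewrite -(percolation_expect_cst E p c).
rewrite ler_norml -percolation_expectN; apply/andP; split;
  by apply: ler_percolation_expect => // F /Xc; rewrite ler_norml => /andP[].
Qed.

Lemma percolation_expect_set0 p X : percolation_expect set0 p X = X set0.
Proof.
rewrite /percolation_expect powerset0 big_set1 /percolation_weight big_set0.
by rewrite mul1r.
Qed.

(** Revealing one edge first: independence turns the expectation over [e |: E]
    into a mixture of two expectations over [E]. All inductions on the edge
    set go through this identity. *)
Lemma percolation_expect_setU1 E p e X : e \notin E ->
  percolation_expect (e |: E) p X
  = p * percolation_expect E p (fun F => X (e |: F))
    + (1 - p) * percolation_expect E p X.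
Proof.
move=> eE; rewrite {1}/percolation_expect (bigID (fun F => e \in F)) /=.
have notin F : F \subset E -> e \notin F.
  by move=> sFE; apply: contra eE; apply: (subsetP sFE).
congr (_ + _).
  rewrite /percolation_expect mulr_sumr.
  rewrite (reindex_onto (fun F => e |: F) (fun F => F :\ e)) /=; last first.
    by move=> F /andP[_ eF]; rewrite setD1K.
  apply: eq_big => F; last first.
    case/andP=> [/andP[sF _] /eqP FK].
    rewrite mulrA; congr (_ * _).
    rewrite /percolation_weight big_setU1 //= setU11; congr (_ * _).
    apply: eq_bigr => f fE; rewrite in_setU1.
    by have /negPf-> : f != e by apply: contraNneq eE => <-.
  rewrite !powersetE setU11 andbT; apply/andP/idP=> [[sF /eqP <-]|sFE].
    by rewrite subDset.
  by rewrite setUS // setU1K ?notin.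
rewrite /percolation_expect mulr_sumr.
apply: eq_big => F.
  rewrite !powersetE; apply/andP/idP=> [[sF eF]|sFE].
    apply/subsetP=> f fF; move/subsetP: sF => /(_ f fF); rewrite in_setU1.
    by case/orP=> // /eqP ef; rewrite ef (negPf eF) in fF.
  by split; [apply: subset_trans sFE (subsetUr _ _) | exact: notin].
case/andP=> _ eF; rewrite mulrA /percolation_weight big_setU1 //=.
by rewrite (negPf eF).
Qed.

End Percolation.

(** * Concentration of edge-Lipschitz functions *)

Definition edge_lipschitz (R : realFieldType) (T : finType)
    (E : {set {set T}}) (c : R) (X : {set {set T}} -> R) : Prop :=
  forall (F : {set {set T}}) (e : {set T}), F \subset E -> e \in E -> e \notin F ->
    `|X (e |: F) - X F| <= c.

Lemma edge_lipschitzN (R : realFieldType) (T : finType)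
    (E : {set {set T}}) (c : R) (X : {set {set T}} -> R) :
  edge_lipschitz E c X -> edge_lipschitz E c (fun F => - X F).
Proof.
by move=> lipX F e sFE eE eF; rewrite -opprD normrN lipX.
Qed.

Section Concentration.
Variables (R : realType) (T : finType).
Implicit Types (E F : {set {set T}}) (e : {set T}) (p c : R).
Implicit Types (X : {set {set T}} -> R).

Lemma expR_le_quadratic (x : R) : x <= 1 / 2 -> expR x <= 1 + x + 2 * x ^+ 2.
Proof.
move=> x2; have x1 : 0 < 1 - x by lra.
have : expR x <= (1 - x)^-1.
  by rewrite -[x in expR x]opprK expRN lef_pV2 ?posrE ?expR_gt0 ?expR_ge1Dx.
move/le_trans; apply; rewrite -div1r ler_pdivrMr //.
suff -> : (1 + x + 2 * x ^+ 2) * (1 - x) = 1 + x ^+ 2 * (1 - 2 * x).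
  by rewrite lerDl mulr_ge0 ?sqr_ge0 //; lra.
by ring.
Qed.

(** The exponential moment of a two-point variable. Its variance
    [p (1 - p) (x1 - x0) ^ 2] is bounded keeping the factor [p], which is what
    makes [mu], rather than the number of edges, govern the final rate. *)
Lemma expR_bernoulli_mix p (x1 x0 : R) : 0 <= p <= 1 -> `|x1 - x0| <= 1 / 2 ->
  p * expR x1 + (1 - p) * expR x0
    <= expR (p * x1 + (1 - p) * x0 + 2 * p * (x1 - x0) ^+ 2).
Proof.
move=> /andP[p0 p1] dle; set d := x1 - x0 in dle *.
set a := p * x1 + (1 - p) * x0.
have -> : x1 = a + (1 - p) * d by rewrite /a /d; ring.
have -> : x0 = a + (- p * d) by rewrite /a /d; ring.
move: (a) (d) dle => {}a {}d dle.
rewrite !expRD !(mulrCA _ (expR a)) -mulrDr ler_pM2l ?expR_gt0 //.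
move: dle; rewrite ler_norml => /andP[dl du].
have h1 : expR ((1 - p) * d) <= 1 + (1 - p) * d + 2 * ((1 - p) * d) ^+ 2.
  by apply: expR_le_quadratic; nra.
have h0 : expR (- p * d) <= 1 + - p * d + 2 * (- p * d) ^+ 2.
  by apply: expR_le_quadratic; nra.
apply: le_trans (expR_ge1Dx _).
have q0 : 0 <= 1 - p by lra.
apply: le_trans (lerD (ler_wpM2l p0 h1) (ler_wpM2l q0 h0)) _.
rewrite -subr_ge0.
have -> : 1 + 2 * p * d ^+ 2 -
   (p * (1 + (1 - p) * d + 2 * ((1 - p) * d) ^+ 2) +
    (1 - p) * (1 + - p * d + 2 * (- p * d) ^+ 2)) = 2 * (p * d) ^+ 2 by ring.
by rewrite mulr_ge0 ?sqr_ge0.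
Qed.

(** After revealing the edge [e], the induction hypothesis bounds both
    conditional exponential moments with the same variance term; the two
    conditional means differ by at most [c], so that their mixture is an
    instance of [expR_bernoulli_mix]. *)
Lemma percolation_expR_le E p c (l : R) X :
  0 <= p <= 1 -> 0 <= c -> 0 <= l -> l * c <= 1 / 2 -> edge_lipschitz E c X ->
  percolation_expect E p (fun F => expR (l * X F))
    <= expR (l * percolation_expect E p X + 2 * (l * c) ^+ 2 * (#|E|%:R * p)).
Proof.
move=> p01 c0 l0 lc; have [n] := ubnP #|E|.
have [/andP[p0 p1]] := p01.
elim: n => // n IHn in E X *; have [->|[e eE]] := set_0Vmem E.
  by move=> _ _; rewrite !percolation_expect_set0 cards0 mul0r mulr0 addr0.
rewrite -(setD1K eE) ltnS; move: (E :\ e) (setD11 e E) => {}E /negbT {}eE.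
rewrite cardsU1 eE add1n => ltEn lipX.
have lip1 : edge_lipschitz E c (fun F => X (e |: F)).
  move=> F f sFE fE fF; rewrite setUCA; apply: lipX.
  - by rewrite setUS.
  - by rewrite setU1r.
  - by rewrite in_setU1 negb_or fF andbT; apply: contraNneq eE => <-.
have lip0 : edge_lipschitz E c X.
  move=> F f sFE fE fF; apply: lipX fF; last by rewrite setU1r.
  exact: subset_trans sFE (subsetUr _ _).
rewrite !percolation_expect_setU1 //.
set a1 := percolation_expect E p (fun F => X (e |: F)).
set a0 := percolation_expect E p X.
have da : `|l * a1 - l * a0| <= l * c.
  rewrite -mulrBr normrM (ger0_norm l0) ler_wpM2l //.
  rewrite -percolation_expectB ler_norm_percolation_expect // => F sFE.
  apply: lipX; rewrite ?setU11 //; first exact: subset_trans sFE (subsetUr _ _).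
  by apply: contra eE; apply: (subsetP sFE).
have IH1 := IHn E _ ltEn lip1; have IH0 := IHn E _ ltEn lip0.
rewrite -/a1 in IH1; rewrite -/a0 in IH0.
have q0 : 0 <= 1 - p by lra.
apply: le_trans (lerD (ler_wpM2l p0 IH1) (ler_wpM2l q0 IH0)) _.
rewrite !expRD !mulrA -mulrDl.
apply: le_trans (ler_wpM2r (expR_ge0 _) (expR_bernoulli_mix p01 _)) _.
  exact: le_trans da lc.
rewrite -!expRD ler_expR -natr1.
have sq : (l * a1 - l * a0) ^+ 2 <= (l * c) ^+ 2.
  by rewrite -real_normK ?num_real // lerXn2r ?nnegrE ?mulr_ge0.
have := ler_wpM2l p0 sq; rewrite -subr_ge0 => h.
rewrite -subr_ge0; apply: le_trans (mulr_ge0 (ler0n _ 2) h) _.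
by rewrite le_eqVlt; apply/orP; left; apply/eqP; ring.
Qed.

(** Chernoff's argument: the indicator of the event is at most
    [expR (l * (X F - percolation_expect E p X - s))]. *)
Lemma percolation_tail_le E p c (l s : R) X :
  0 <= p <= 1 -> 0 <= c -> 0 <= l -> l * c <= 1 / 2 -> edge_lipschitz E c X ->
  percolation_prob E p (fun F => s <= X F - percolation_expect E p X)
    <= expR (- (l * s) + 2 * (l * c) ^+ 2 * (#|E|%:R * p)).
Proof.
move=> p01 c0 l0 lc lipX; rewrite percolation_probE.
set a := percolation_expect E p X.
apply: (@le_trans _ _ (percolation_expect E p
    (fun F => expR (- (l * (s + a))) * expR (l * X F)))).
  apply: ler_percolation_expect => // F _; rewrite -expRD.
  have [sX|_] := boolP (s <= _); last exact: expR_ge0.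
  apply: le_trans (expR_ge1Dx _); rewrite lerDl addrC -mulrBr mulr_ge0 //.
  by move: sX; lra.
rewrite percolation_expectZ.
apply: le_trans (ler_wpM2l (expR_ge0 _) (percolation_expR_le p01 c0 l0 lc lipX)) _.
by rewrite -expRD ler_expR -/a le_eqVlt; apply/orP; left; apply/eqP; ring.
Qed.

End Concentration.

(** * Concentration when influences are inverse to the number of edges *)

Section ScaledConcentration.
Variables (R : realType) (T : finType).
Implicit Types (E F : {set {set T}}) (e : {set T}) (p : R).
Implicit Types (X : {set {set T}} -> R).

Lemma percolation_expect_card E p :
  percolation_expect E p (fun F => #|F|%:R) = #|E|%:R * p.
Proof.
have [n] := ubnP #|E|; elim: n => // n IHn in E *.
have [->|[e eE]] := set_0Vmem E.
  by rewrite percolation_expect_set0 !cards0 mul0r.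
rewrite -(setD1K eE) ltnS; move: (E :\ e) (setD11 e E) => {}E /negbT {}eE.
rewrite cardsU1 eE add1n => /IHn IH; rewrite percolation_expect_setU1 // IH.
have -> : percolation_expect E p (fun F => #|e |: F|%:R) =
          percolation_expect E p (fun F => 1 + #|F|%:R).
  apply: eq_bigr => F; rewrite powersetE => sFE.
  have eF : e \notin F by apply: contra eE; apply: (subsetP sFE).
  by rewrite cardsU1 eF natrD.
by rewrite percolation_expectD percolation_expect_cst IH -natr1; ring.
Qed.

Lemma percolation_prob_le1 E p (A : pred {set {set T}}) :
  0 <= p <= 1 -> percolation_prob E p A <= 1.
Proof.
move=> p01; rewrite percolation_probE -[leRHS](percolation_expect_cst E p 1).
by apply: ler_percolation_expect => // F _; case: (A F).
Qed.

Lemma percolation_prob_union3 E p (A B C D : pred {set {set T}}) :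
  0 <= p <= 1 -> (forall F, F \subset E -> A F -> [|| B F, C F | D F]) ->
  percolation_prob E p A
    <= percolation_prob E p B + percolation_prob E p C + percolation_prob E p D.
Proof.
move=> p01 ABCD; rewrite !percolation_probE -!percolation_expectD.
apply: ler_percolation_expect => // F /ABCD.
case: (A F) => [/(_ isT)|_]; last by rewrite !addr_ge0.
by case: (B F); case: (C F); case: (D F) => // _; rewrite -?natrD ler_nat.
Qed.

(** The lower tail of a binomial variable, obtained from the general bound for
    the 1-Lipschitz function [- #|F|] with [l = 1 / 8]. *)
Lemma percolation_few_edges_le E p :
  0 <= p <= 1 ->
  percolation_prob E p (fun F => #|F|%:R <= #|E|%:R * p / 2)
    <= expR (- (#|E|%:R * p / 32)).
Proof.
move=> p01; set mu := _ * p.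
have lip : edge_lipschitz E 1 (fun F => - #|F|%:R : R).
  apply: edge_lipschitzN => F e _ _ eF.
  by rewrite cardsU1 eF natrD addrK normr1.
have l8 : 1 / 8 * 1 <= 1 / 2 :> R by lra.
have := percolation_tail_le (mu / 2) p01 ler01 _ l8 lip.
rewrite percolation_expectN percolation_expect_card -/mu.
have -> : - (1 / 8 * (mu / 2)) + 2 * (1 / 8 * 1) ^+ 2 * mu = - (mu / 32).
  by field.
move=> /(_ ltac:(lra)); apply: le_trans.
rewrite !percolation_probE; apply: ler_percolation_expect => // F _.
have [h|//] := boolP (#|F|%:R <= _).
by have -> : mu / 2 <= - #|F|%:R - - mu by move: h; lra.
Qed.

(** The factor damps [X] linearly on subgraphs with fewer than half of the
    expected number [mu] of edges, exactly where single edges have too much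
    influence. *)
Definition edge_truncation (mu : R) (X : {set {set T}} -> R) F : R :=
  X F * Num.min 1 (2 / mu * #|F|%:R).

(** In the product rule, the change of [X], of size [3 / (m + 1)], comes with a
    factor at most [2 m / mu], and the change of the damping factor, at most
    [2 / mu], comes with [|X| <= 1]; together [6 / mu + 2 / mu]. *)
Lemma edge_truncation_lipschitz E (mu : R) X :
  0 < mu -> (forall F, F \subset E -> `|X F| <= 1) ->
  (forall F e, F \subset E -> e \in E -> e \notin F ->
    (#|F|%:R + 1) * `|X (e |: F) - X F| <= 3) ->
  edge_lipschitz E (8 / mu) (edge_truncation mu X).
Proof.
move=> mu0 X1 X3 F e sFE eE eF; rewrite /edge_truncation.
rewrite cardsU1 eF add1n -[#|F|.+1%:R]natr1.
have seFE : e |: F \subset E by rewrite subUset sub1set eE.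
move: (X3 F e sFE eE eF) (X1 _ seFE).
set m : R := #|F|%:R; move: (X (e |: F)) (X F) => x' x.
have m0 : 0 <= m by apply: ler0n.
have r0 : 0 < 2 / mu by rewrite divr_gt0.
have -> : 8 / mu = 2 / mu * 4 by field; lra.
move: (2 / mu) r0 => r r0 h3 h1.
set u := Num.min 1 (r * m); set u' := Num.min 1 (r * (m + 1)).
have [u0 um] : 0 <= u /\ u <= r * m.
  by split; rewrite /u ?ge_min ?lexx ?orbT // le_min ler01 mulr_ge0 // ltW.
have [d0 d1] : 0 <= u' - u /\ u' - u <= r.
  have e1 : r * (m + 1) = r * m + r by ring.
  by rewrite /u /u' e1; split;
    case: (leP 1 (r * m)) => ?; case: (leP 1 (r * m + r)) => ?; lra.
have -> : x' * u' - x * u = (x' - x) * u + x' * (u' - u) by ring.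
apply: le_trans (ler_normD _ _) _; rewrite !normrM (ger0_norm u0) (ger0_norm d0).
set d := `|x' - x| in h3 *.
have dpos : 0 <= d by apply: normr_ge0.
have i1 : d * u <= d * (r * m) by rewrite ler_wpM2l.
have i2 : `|x'| * (u' - u) <= 1 * r by apply: ler_pM.
have i3 : r * ((m + 1) * d) <= r * 3 by rewrite ler_pM2l.
have i4 : 0 <= r * d by rewrite mulr_ge0 // ltW.
have e5 : d * (r * m) = r * ((m + 1) * d) - r * d by ring.
by lra.
Qed.

Lemma edge_truncation_close (mu : R) X F :
  0 < mu -> `|X F| <= 1 ->
  `|X F - edge_truncation mu X F| <= (#|F|%:R <= mu / 2)%R%:R.
Proof.
move=> mu0 X1; rewrite /edge_truncation -{1}[X F]mulr1 -mulrBr normrM.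
have m0 : 0 <= 2 / mu * #|F|%:R by rewrite mulr_ge0 // divr_ge0 // ltW.
case: (leP _ (mu / 2)) => [_|lt]; last first.
  have : 1 <= 2 / mu * #|F|%:R by rewrite mulrAC ler_pdivlMr // mul1r; lra.
  by move/min_l ->; rewrite subrr normr0 mulr0.
apply: mulr_ile1 => //.
by rewrite ger0_norm ?subr_ge0 ?ge_min ?lexx // lerBlDr lerDl le_min ler01.
Qed.

Lemma expR_ge_id (x : R) : x <= expR x.
Proof. by apply: le_trans (expR_ge1Dx x); rewrite lerDr ler01. Qed.

(** Only [t <= 2] matters since [|X| <= 1], and then the probability
    [expR (- (mu / 32))] of having few edges is itself of the desired form.
    Up to that event, and up to the equally small difference of the means, [X]
    is its truncation, whose tails are bounded at [t / 2]. *)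
Lemma scaled_lipschitz_concentration E p X (t : R) :
  0 < p -> p < 1 -> 0 <= t ->
  (forall F, F \subset E -> `|X F| <= 1) ->
  (forall F e, F \subset E -> e \in E -> e \notin F ->
    (#|F|%:R + 1) * `|X (e |: F) - X F| <= 3) ->
  percolation_prob E p (fun F => t <= `|X F - percolation_expect E p X|)
    < 2 * expR (- (1 / 4096 * (#|E|%:R * p) * t ^+ 2)).
Proof.
move=> p0 p1 t0 X1 X3; have p01 : 0 <= p <= 1 by rewrite !ltW.
set mu := #|E|%:R * p; set a := percolation_expect E p X.
have mu0 : 0 <= mu by rewrite mulr_ge0 // ltW.
set y := expR _; have y0 : 0 < y := expR_gt0 _.
(* With y = exp (- eta mu t^2) and twice the final rate, the total below is
   3 y^2, which is smaller than 2 y when y <= 1/2. *)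
have [ylarge|ysmall] := ltP (1 / 2) y.
  by apply: le_lt_trans (percolation_prob_le1 _ _ p01) _; lra.
have big : 64 < mu * t ^+ 2.
  have := expR_ge1Dx (- (1 / 4096 * mu * t ^+ 2)); rewrite -/y -mulrA.
  by lra.
have a1 : `|a| <= 1 by apply: ler_norm_percolation_expect.
have [t2|t2] := ltP 2 t.
  apply: (@le_lt_trans _ _ 0); last by rewrite mulr_gt0.
  rewrite percolation_probE -[leRHS](percolation_expect_cst E p 0).
  apply: ler_percolation_expect => // F /X1 XF.
  have [h|//] := boolP (t <= _).
  by have := ler_normB (X F) a; lra.
have mupos : 0 < mu.
  by rewrite lt_neqAle mu0 andbT; apply: contraTneq big => <-; rewrite mul0r -leNgt.
set d := expR (- (mu / 32)).
have d0 : 0 < d := expR_gt0 _.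
(* t <= 2 d would give mu t^2 <= 4 mu exp (- mu / 16) <= 64 *)
have td : 2 * d < t.
  rewrite ltNge; apply: contraTN big => td; rewrite -leNgt.
  have : t ^+ 2 <= (2 * d) ^+ 2 by rewrite lerXn2r ?nnegrE // mulr_ge0 ?ltW.
  have dd : d ^+ 2 = (expR (mu / 16))^-1.
    by rewrite expr2 -expRD -expRN; congr expR; field.
  move/(ler_wpM2l mu0)/le_trans; apply.
  rewrite exprMn dd mulrCA mulrA ler_pdivrMr ?expR_gt0 //.
  by have := expR_ge_id (mu / 16); lra.
set g := edge_truncation mu X.
have lipg : edge_lipschitz E (8 / mu) g by apply: edge_truncation_lipschitz.
have few := percolation_few_edges_le E p01; rewrite -/mu -/d in few.
have close F : F \subset E -> `|X F - g F| <= (#|F|%:R <= mu / 2)%R%:R.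
  by move=> /X1; apply: edge_truncation_close.
have /andP[ag1 ag2] : - d <= a - percolation_expect E p g <= d.
  rewrite -percolation_expectB -ler_norml; apply: le_trans few.
  rewrite percolation_probE ler_norml -percolation_expectN; apply/andP; split;
    by apply: ler_percolation_expect => // F /close; rewrite ler_norml => /andP[].
(* l = mu t / 512 minimises - l t / 2 + 2 l^2 (8 / mu)^2 mu. *)
have lg : 1 / 512 * mu * t * (8 / mu) <= 1 / 2.
  have -> : 1 / 512 * mu * t * (8 / mu) = t / 64 by field; lra.
  by lra.
have l0 : 0 <= 1 / 512 * mu * t by rewrite !mulr_ge0 //; lra.
have c0 : 0 <= 8 / mu by rewrite divr_ge0.
have up := percolation_tail_le (t / 2) p01 c0 l0 lg lipg.
have dn := percolation_tail_le (t / 2) p01 c0 l0 lg (edge_lipschitzN lipg).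
rewrite -/mu percolation_expectN in up dn.
have ex : - (1 / 512 * mu * t * (t / 2)) + 2 * (1 / 512 * mu * t * (8 / mu)) ^+ 2 * mu
        = - (1 / 4096 * mu * t ^+ 2) + - (1 / 4096 * mu * t ^+ 2).
  by field; lra.
rewrite ex expRD -/y in up dn.
have dy : d <= y ^+ 2.
  rewrite expr2 -expRD ler_expR.
  suff : mu * (t * t) <= mu * 4 by rewrite expr2; lra.
  by rewrite ler_wpM2l //; nra.
apply: (@le_lt_trans _ _ (y ^+ 2 + y ^+ 2 + y ^+ 2)).
  apply: le_trans (lerD (lerD (le_trans few dy) up) dn).
  apply: percolation_prob_union3 => // F sFE.
  have := close F sFE; case: (leP _ (mu / 2)) => //= _.
  rewrite normr_le0 subr_eq0 => /eqP ->.
  rewrite ler_normr => /orP[h|h]; apply/orP; [left|right]; lra.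
by nra.
Qed.

End ScaledConcentration.

(** * Influence of one edge on the modularity *)

Section Score.
Variables (T : finType).
Implicit Types (E F P : {set {set T}}) (e A : {set T}).

Lemma edges_within_sum F A : edges_within F A = (\sum_(e in F) (e \subset A))%N.
Proof.
rewrite /edges_within -sum1_card big_mkcond [RHS]big_mkcond /=.
by apply: eq_bigr => e _; rewrite inE; case: (e \in F); case: (e \subset A).
Qed.

Lemma volume_sum F A : volume F A = (\sum_(e in F) #|e :&: A|)%N.
Proof.
rewrite /volume.
transitivity (\sum_(v in A) \sum_(e in F) (v \in e))%N.
  apply: eq_bigr => v _; rewrite /degree -sum1_card big_mkcond [RHS]big_mkcond /=.
  by apply: eq_bigr => e _; rewrite inE; case: (e \in F); case: (v \in e).
rewrite exchange_big /=; apply: eq_bigr => e _.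
rewrite -sum1_card big_mkcond [RHS]big_mkcond /=.
by apply: eq_bigr => v _; rewrite inE; case: (v \in A); case: (v \in e).
Qed.

Lemma edges_within_setU1 F e A : e \notin F ->
  edges_within (e |: F) A = (edges_within F A + (e \subset A))%N.
Proof. by move=> eF; rewrite !edges_within_sum big_setU1 //= addnC. Qed.

Lemma volume_setU1 F e A : e \notin F ->
  volume (e |: F) A = (volume F A + #|e :&: A|)%N.
Proof. by move=> eF; rewrite !volume_sum big_setU1 //= addnC. Qed.

Lemma sum_card_setI P e : partition P [set: T] ->
  (\sum_(A in P) #|e :&: A|)%N = #|e|.
Proof.
move=> partP.
have -> : #|e| = (\sum_(v in [set: T]) (v \in e))%N.
  rewrite -sum1_card big_mkcond [RHS]big_mkcond /=.
  by apply: eq_bigr => v _; rewrite inE; case: (v \in e).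
rewrite (set_partition_big _ partP) /=; apply: eq_bigr => A _.
rewrite -sum1_card big_mkcond [RHS]big_mkcond /=.
by apply: eq_bigr => v _; rewrite inE; case: (v \in A); case: (v \in e).
Qed.

Lemma sum_subset_le1 P e : partition P [set: T] -> #|e| = 2%N ->
  (\sum_(A in P) (e \subset A) <= 1)%N.
Proof.
move=> partP e2; rewrite -(leq_pmul2l (isT : 0 < 2)%N) muln1 -{2}e2.
rewrite -(sum_card_setI e partP) big_distrr; apply: leq_sum => A _ /=.
by case: (boolP (e \subset A)) => [/setIidPl ->|]; rewrite ?e2.
Qed.

Lemma sum_edges_within_le P F : partition P [set: T] -> simple_graph F ->
  (\sum_(A in P) edges_within F A <= #|F|)%N.
Proof.
move=> partP sF; rewrite (eq_bigr _ (fun A _ => edges_within_sum F A)).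
rewrite exchange_big -sum1_card; apply: leq_sum => e /sF.
exact: sum_subset_le1.
Qed.

Lemma sum_volume P F : partition P [set: T] -> simple_graph F ->
  (\sum_(A in P) volume F A = 2 * #|F|)%N.
Proof.
move=> partP sF; rewrite (eq_bigr _ (fun A _ => volume_sum F A)).
rewrite exchange_big -sum1_card big_distrr; apply: eq_bigr => e /sF <- /=.
by rewrite muln1 sum_card_setI.
Qed.

Lemma volume_le P F A : partition P [set: T] -> simple_graph F -> A \in P ->
  (volume F A <= 2 * #|F|)%N.
Proof. by move=> partP sF AP; rewrite -(sum_volume partP sF) (bigD1 A) //= leq_addr. Qed.

(** Each volume is at most the total volume [2 m], and they add up to [2 m]. *)
Lemma sum_volume_sqr_le P F : partition P [set: T] -> simple_graph F ->
  (\sum_(A in P) volume F A ^ 2 <= 4 * #|F| ^ 2)%N.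
Proof.
move=> partP sF; rewrite (_ : 4 * #|F| ^ 2 = 2 * #|F| * (2 * #|F|))%N; last by lia.
rewrite -{2}(sum_volume partP sF) big_distrr; apply: leq_sum => A AP /=.
by rewrite -mulnn leq_mul2r (volume_le partP sF AP) orbT.
Qed.

(** The part [A] gains volume [k = #|e :&: A| <= 2], so its square grows by
    [2 * volume F A * k + k ^ 2 <= (4 m + 2) k]; the [k] add up to [2]. *)
Lemma sum_volume_sqr_setU1 P F e : partition P [set: T] -> simple_graph F ->
  e \notin F -> #|e| = 2%N ->
  (\sum_(A in P) volume F A ^ 2 <= \sum_(A in P) volume (e |: F) A ^ 2
     <= \sum_(A in P) volume F A ^ 2 + (8 * #|F| + 4))%N.
Proof.
move=> partP sF eF e2; apply/andP; split.
  by apply: leq_sum => A _; rewrite volume_setU1 // leq_sqr leq_addr.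
have -> : (8 * #|F| + 4 = \sum_(A in P) (4 * #|F| + 2) * #|e :&: A|)%N.
  by rewrite -big_distrr sum_card_setI //= e2; lia.
rewrite -big_split; apply: leq_sum => A AP /=; rewrite volume_setU1 //.
have := volume_le partP sF AP.
have : (#|e :&: A| <= 2)%N by rewrite -e2 subset_leq_card ?subsetIl.
move: #|e :&: A| (volume F A) => k v k2 vm.
rewrite sqrnD -addnA leq_add2l mulnDl addnC leq_add //.
  by rewrite (_ : 4 * #|F| * k = 2 * (2 * #|F| * k))%N ?leq_mul //; lia.
by rewrite -mulnn leq_mul.
Qed.

Lemma sum_edges_within_setU1 P F e : partition P [set: T] ->
  e \notin F -> #|e| = 2%N ->
  (\sum_(A in P) edges_within F A <= \sum_(A in P) edges_within (e |: F) A
     <= \sum_(A in P) edges_within F A + 1)%N.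
Proof.
move=> partP eF e2.
rewrite (eq_bigr _ (fun A _ => edges_within_setU1 A eF)) big_split /=.
by rewrite leq_addr leq_add2l sum_subset_le1.
Qed.

Variable R : realFieldType.

(** The edgeless case needs no separate treatment because division by zero
    gives zero. *)
Lemma modularity_scoreE P F : modularity_score R P F =
  (\sum_(A in P) edges_within F A)%:R / #|F|%:R
  - (\sum_(A in P) volume F A ^ 2)%:R / (4 * #|F|%:R ^+ 2).
Proof.
rewrite /modularity_score; case: eqP => [->|_].
  by rewrite cards0 expr0n mulr0 invr0 !mulr0 subrr.
rewrite !natr_sum mulrC [in RHS]mulrC -mulrC; congr (_ - _).
by rewrite mulrC; congr (_ / _); apply: eq_bigr => A _; rewrite natrX.
Qed.

(** [s / m] is the proportion of edges lying inside a part. Here and in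
    [square_ratio_change], [m = 0] is included with the ratio [0]. *)
Lemma ratio_change (m s s' : R) : 0 <= m -> 0 <= s -> s <= m ->
  s <= s' <= s + 1 -> (m + 1) * `|s' / (m + 1) - s / m| <= 1.
Proof.
move=> m0 s0 sm /andP[s1 s2]; have m1 : 0 < m + 1 by lra.
have -> : (m + 1) * `|s' / (m + 1) - s / m| = `|(s' - s) - s / m|.
  rewrite -{1}[m + 1]gtr0_norm // -normrM; congr `|_|.
  have [m_eq0|mn0] := eqVneq m 0; last by field; rewrite mn0; lra.
  have -> : s = 0 by lra.
  by rewrite m_eq0 !mul0r add0r divr1 mul1r; ring.
have r0 : 0 <= s / m by rewrite divr_ge0.
have r1 : s / m <= 1.
  have [->|mn0] := eqVneq m 0; first by rewrite invr0 mulr0.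
  by rewrite ler_pdivrMr ?mul1r // lt_neqAle eq_sym mn0.
by rewrite ler_norml; lra.
Qed.

(** [v / (4 m ^ 2)] is the sum of the squared proportions of volume. *)
Lemma square_ratio_change (m v v' : R) : 0 <= m -> 0 <= v -> v <= 4 * m ^+ 2 ->
  v <= v' <= v + (8 * m + 4) ->
  (m + 1) * `|v' / (4 * (m + 1) ^+ 2) - v / (4 * m ^+ 2)| <= 2.
Proof.
move=> m0 v0 vm /andP[v1 v2]; have m1 : 0 < m + 1 by lra.
set r := v / (4 * m ^+ 2).
have r0 : 0 <= r by rewrite divr_ge0 // mulr_ge0 // sqr_ge0.
have vE : v = 4 * m ^+ 2 * r.
  have [m_eq0|mn0] := eqVneq m 0; last by rewrite /r; field.
  by rewrite m_eq0 expr0n mulr0 mul0r; move: vm; rewrite m_eq0 expr0n mulr0; lra.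
have r1 : r <= 1.
  have [m_eq0|mn0] := eqVneq m 0; first by rewrite /r m_eq0 expr0n mulr0 invr0 mulr0.
  by rewrite /r ler_pdivrMr ?mul1r // mulr_gt0 // exprn_gt0 // lt_neqAle eq_sym mn0.
have -> : (m + 1) * `|v' / (4 * (m + 1) ^+ 2) - r|
        = `|(v' - v) - 4 * r * (2 * m + 1)| / (4 * (m + 1)).
  rewrite -[X in X * _ = _]gtr0_norm // -normrM.
  rewrite -[X in _ = _ / X]gtr0_norm ?mulr_gt0 // -normf_div; congr `|_|.
  by rewrite [v]vE; field; lra.
rewrite ler_pdivrMr ?mulr_gt0 // ler_norml.
have i1 : r * (2 * m + 1) <= 1 * (2 * m + 1) by rewrite ler_wpM2r //; lra.
have i2 : 0 <= r * (2 * m + 1) by rewrite mulr_ge0 //; lra.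
rewrite -[4 * r * _]mulrA; lra.
Qed.

Lemma modularity_score_norm_le1 P F : partition P [set: T] -> simple_graph F ->
  `|modularity_score R P F| <= 1.
Proof.
move=> partP sF; rewrite modularity_scoreE.
have S1 := sum_edges_within_le partP sF; have V1 := sum_volume_sqr_le partP sF.
rewrite -(ler_nat R) in S1; rewrite -(ler_nat R) natrM natrX in V1.
have [F0|Fpos] := posnP #|F|.
  by rewrite F0 expr0n mulr0 !invr0 !mulr0 subrr normr0.
have Fp : 0 < #|F|%:R :> R by rewrite ltr0n.
have a0 : 0 <= (\sum_(A in P) edges_within F A)%:R / #|F|%:R :> R.
  by rewrite divr_ge0.
have a1 : (\sum_(A in P) edges_within F A)%:R / #|F|%:R <= 1 :> R.
  by rewrite ler_pdivrMr // mul1r.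
have b0 : 0 <= (\sum_(A in P) volume F A ^ 2)%:R / (4 * #|F|%:R ^+ 2) :> R.
  by rewrite divr_ge0 // mulr_ge0 // sqr_ge0.
have b1 : (\sum_(A in P) volume F A ^ 2)%:R / (4 * #|F|%:R ^+ 2) <= 1 :> R.
  by rewrite ler_pdivrMr ?mul1r // mulr_gt0 // exprn_gt0.
by rewrite ler_norml; lra.
Qed.

Lemma modularity_score_setU1 P F e : partition P [set: T] -> simple_graph F ->
  e \notin F -> #|e| = 2%N ->
  (#|F|%:R + 1) * `|modularity_score R P (e |: F) - modularity_score R P F| <= 3.
Proof.
move=> partP sF eF e2; rewrite !modularity_scoreE cardsU1 eF add1n -natr1.
have S0 := sum_edges_within_le partP sF; have V0 := sum_volume_sqr_le partP sF.
have := sum_edges_within_setU1 partP eF e2.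
have := sum_volume_sqr_setU1 partP sF eF e2.
move=> V1 S1.
rewrite -(ler_nat R) in S0; rewrite -(ler_nat R) natrM natrX in V0.
rewrite -!(ler_nat R) natrD (natrD _ (8 * _)) (natrM _ 8) in V1.
rewrite -!(ler_nat R) natrD in S1.
have hS := ratio_change (ler0n R _) (ler0n R _) S0 S1.
have hV := square_ratio_change (ler0n R _) (ler0n R _) V0 V1.
apply: (@le_trans _ _ (1 + 2)); last by lra.
apply: le_trans (lerD hS hV); rewrite -mulrDr ler_wpM2l ?addr_ge0 //.
apply: le_trans (ler_normB _ _); rewrite le_eqVlt; apply/orP; left.
by apply/eqP; congr `|_|; ring.
Qed.

Lemma modularity_norm_le1 F : simple_graph F -> `|modularity R F| <= 1.
Proof.
move=> sF; have [P partP ->] := modularity_attained R F.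
exact: modularity_score_norm_le1.
Qed.

(** Comparing both graphs on an optimal partition of either one: a maximum
    varies no more than the functions it ranges over. *)
Lemma modularity_setU1 F e : simple_graph F -> e \notin F -> #|e| = 2%N ->
  (#|F|%:R + 1) * `|modularity R (e |: F) - modularity R F| <= 3.
Proof.
move=> sF eF e2.
have m1 : 0 < #|F|%:R + 1 :> R by rewrite natr1 ltr0n.
rewrite mulrC -ler_pdivlMr // ler_norml.
have [P partP qP] := modularity_attained R F.
have [Q partQ qQ] := modularity_attained R (e |: F).
have := modularity_score_setU1 partP sF eF e2.
have := modularity_score_setU1 partQ sF eF e2.
rewrite ![_ * `|_|]mulrC -!ler_pdivlMr // !ler_norml -qP -qQ.
have := modularity_ub R (e |: F) partP; have := modularity_ub R F partQ.
by move=> ? ? /andP[? ?] /andP[? ?]; lra.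
Qed.

End Score.

Theorem theorem2p2 (R : realType) :
  exists2 eta : R, 0 < eta &
    forall (T : finType) (E : {set {set T}}) (P : {set {set T}}) (p : R),
      simple_graph E -> partition P [set: T] -> 0 < p -> p < 1 ->
      let mu := #|E|%:R * p in
      forall t : R, 0 <= t ->
        percolation_prob E p (fun F : {set {set T}} =>
            t <= `|modularity_score R P F
                   - percolation_expect E p (modularity_score R P)|)
          < 2 * expR (- (eta * mu * t ^+ 2))
        /\
        percolation_prob E p (fun F : {set {set T}} =>
            t <= `|modularity R F - percolation_expect E p (modularity R)|)
          < 2 * expR (- (eta * mu * t ^+ 2)).
Proof.
exists (1 / 4096); first by rewrite divr_gt0.
move=> T E P p simpleE partP p0 p1 mu t t0.
have simple_sub (F : {set {set T}}) : F \subset E -> simple_graph F.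
  by move=> sFE e /(subsetP sFE) /simpleE.
split; apply: scaled_lipschitz_concentration => //.
- by move=> F /simple_sub; apply: modularity_score_norm_le1.
- move=> F e /simple_sub sF eE eF; apply: modularity_score_setU1 => //.
  exact: simpleE.
- by move=> F /simple_sub; apply: modularity_norm_le1.
- move=> F e /simple_sub sF eE eF; apply: modularity_setU1 => //.
  exact: simpleE.
Qed.
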